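(* Let $w,w'\in W$ be such that $\ell(ww')=\ell(w)+\ell(w')$. Then $$\mathbf B(w)\subset\mathbf B(ww'),\qquad T_w(\mathbf B(w'))\subset\mathbf B(ww').$$
   Context: Quantum group. $\mathfrak g$ is a symmetrizable Kac–Moody algebra with Cartan matrix $(a_{ij})_{i,j\in I}$; $Q=\mathbb Z^I$ has standard basis $\{\alpha_i\}_{i\in I}$; $d_i\in\mathbb Z_{>0}$ are fixed with $(d_ia_{ij})$ symmetric; $(\cdot,\cdot):Q\times Q\to\mathbb Z$ is the symmetric bilinear form $(\alpha_i,\alpha_j)=d_ia_{ij}$. Put $\Bbbk=\mathbb Q(q^{1/2})$, $q_i=q^{d_i}$, $\langle s\rangle_v=v^s-v^{-s}$, $\langle k\rangle_v!=\prod_{s=1}^k\langle s\rangle_v$, $X_i^{\langle k\rangle}=X_i^k/\langle k\rangle_{q_i}!$ (for $X=E,F$). $U_q(\mathfrak g)$ is the $\Bbbk$-algebra generated by $E_i,F_i,K_i^{\pm1}$, $i\in I$, with relations $[E_i,F_j]=\delta_{ij}(q_i^{-1}-q_i)(K_i-K_i^{-1})$, $K_iE_j=q_i^{a_{ij}}E_jK_i$, $K_iF_j=q_i^{-a_{ij}}F_jK_i$, $K_iK_j=K_jK_i$, and for $i\ne j$: $\sum_{r+s=1-a_{ij}}(-1)^sE_i^{\langle r\rangle}E_jE_i^{\langle s\rangle}=0=\sum_{r+s=1-a_{ij}}(-1)^sF_i^{\langle r\rangle}F_jF_i^{\langle s\rangle}$. $U_q(\mathfrak n^+)$ is the subalgebra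 generated by the $E_i$. The map $\bar\cdot$ is the anti-linear anti-involution of $U_q(\mathfrak g)$ fixing all generators and sending $q^{1/2}\mapsto q^{-1/2}$. Braid group action. $W$ is the Weyl group, generated by $s_i(\alpha_j)=\alpha_j-a_{ij}\alpha_i$, with length $\ell$; $R(w)$ is the set of reduced words $\mathbf i=(i_1,\dots,i_m)$ of $w$, $m=\ell(w)$. $T_i$ is the unique automorphism of $U_q(\mathfrak g)$ with $T_i(K_j)=K_jK_i^{-a_{ij}}$, $T_i(E_i)=q_i^{-1}K_i^{-1}F_i$, $T_i(F_i)=q_i^{-1}K_iE_i$, and for $j\neq i$ $T_i(E_j)=\sum_{r+s=-a_{ij}}(-1)^rq_i^{s+\frac12a_{ij}}E_i^{\langle r\rangle}E_jE_i^{\langle s\rangle}$, $T_i(F_j)=\sum_{r+s=-a_{ij}}(-1)^rq_i^{s+\frac12a_{ij}}F_i^{\langle r\rangle}F_jF_i^{\langle s\rangle}$; they satisfy the braid relations, so $T_w=T_{i_1}\cdots T_{i_m}$ is well defined for $\mathbf i\in R(w)$. The set $\mathbf B(w)$. For $w\in W$, $\mathbf i\in R(w)$ put $X_{\mathbf i,k}=T_{i_1}\cdots T_{i_{k-1}}(E_{i_k})\in U_q(\mathfrak n^+)$, $\alpha_{\mathbf i}^{(k)}=s_{i_1}\cdots s_{i_{k-1}}(\alpha_{i_k})$, and $X_{\mathbf i}^{\mathbf a}=q^{\frac12\sum_{k<l}(\alpha_{\mathbf i}^{(k)},\alpha_{\mathbf i}^{(l)})a_ka_l}X_{\mathbf i,1}^{a_1}\cdots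 X_{\mathbf i,m}^{a_m}$ for $\mathbf a\in\mathbb Z_{\ge0}^m$. Let $U^{\mathbb A}(w)$ be the $\mathbb Z[q^{1/2},q^{-1/2}]$-subalgebra of $U_q(\mathfrak n^+)$ generated by the $X_{\mathbf i,k}$ (independent of $\mathbf i\in R(w)$). Let $b_{\mathbf i,\mathbf a}$ be the unique element of $U^{\mathbb A}(w)$ with $\overline{b_{\mathbf i,\mathbf a}}=b_{\mathbf i,\mathbf a}$ and $b_{\mathbf i,\mathbf a}-X_{\mathbf i}^{\mathbf a}\in\sum_{\mathbf a'\ne\mathbf a}q^{-1}\mathbb Z[q^{-1}]X_{\mathbf i}^{\mathbf a'}$. The set $\{b_{\mathbf i,\mathbf a}:\mathbf a\in\mathbb Z_{\ge0}^m\}$ is a basis of $U^{\mathbb A}(w)$ and does not depend on $\mathbf i\in R(w)$; it is denoted $\mathbf B(w)$. *)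

(* Defs.v *)
From HB Require Import structures.
From mathcomp Require Import all_boot all_order all_algebra.
From mathcomp Require Import ring.
From mathcomp Require Import boolp classical_sets.

Set Implicit Arguments.
Unset Strict Implicit.
Unset Printing Implicit Defensive.

Import Order.TTheory GRing.Theory Num.Theory.
Local Open Scope ring_scope.
Local Open Scope quotient_scope.

(* A symmetrizable generalized Cartan matrix with a fixed symmetrization.     *)
(* That a_ij = 0 iff a_ji = 0 follows from the last two fields.               *)
Record cartan_datum (I : finType) := CartanDatum {
  cartan : I -> I -> int;
  symd : I -> nat;
  cartan_diag : forall i, cartan i i = 2;
  cartan_off : forall i j, i != j -> cartan i j <= 0;
  symd_gt0 : forall i, (0 < symd i)%N;
  symdP : forall i j,
    (symd i)%:Z * cartan i j = (symd j)%:Z * cartan j i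
}.

Definition kk : fieldType := {fraction {poly rat}}.

(* vq is q^{1/2}. *)
Definition vq : kk := tofrac ('X : {poly rat}).
Definition qq : kk := vq ^+ 2.

Definition polyC_kk (c : rat) : kk := tofrac (c%:P : {poly rat}).

HB.instance Definition _ :=
  GRing.RMorphism.copy polyC_kk (@tofrac {poly rat} \o polyC).

(* Evaluation of a polynomial in q^{1/2} at q^{-1/2}. *)
Definition evalV (p : {poly rat}) : kk := (map_poly polyC_kk p).[vq^-1].

(* The field automorphism of Q(q^{1/2}) sending q^{1/2} to q^{-1/2}; see      *)
(* kbar_rmorph_subproof and kbar_vq.                                          *)
Definition kbar (f : kk) : kk :=
  let x := repr (f : {fraction {poly rat}}) in evalV \n_x / evalV \d_x.

Lemma vq_neq0 : vq != 0.
Proof. by rewrite tofrac_eq0 polyX_eq0. Qed.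

Lemma map_polyC_kk_vq (p : {poly rat}) :
  (map_poly polyC_kk p).[vq] = tofrac p.
Proof.
have -> : map_poly polyC_kk p = map_poly (@tofrac {poly rat}) (map_poly polyC p).
  by rewrite -map_poly_comp.
by rewrite horner_map /= -[(map_poly _ _).['X]]/(p \Po 'X) comp_polyXr.
Qed.

Lemma evalV_rmorph_subproof : zmod_morphism evalV * monoid_morphism evalV.
Proof.
split; first by move=> p r; rewrite /evalV rmorphB hornerD hornerN.
by split=> [|p r]; rewrite /evalV ?rmorph1 ?hornerC // rmorphM hornerM.
Qed.

HB.instance Definition _ :=
  GRing.isZmodMorphism.Build {poly rat} kk evalV evalV_rmorph_subproof.1.
HB.instance Definition _ :=
  GRing.isMonoidMorphism.Build {poly rat} kk evalV evalV_rmorph_subproof.2.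

Lemma evalV_eq0 p : (evalV p == 0) = (p == 0).
Proof.
apply/eqP/eqP => [|->]; last exact: rmorph0.
rewrite /evalV horner_coef size_map_poly => h.
pose r := \poly_(i < size p) p`_((size p).-1 - i).
have r0 : r = 0.
  apply/eqP; rewrite -tofrac_eq0 -map_polyC_kk_vq.
  have /eqP : vq ^+ (size p).-1 *
      (\sum_(i < size p) (map_poly polyC_kk p)`_i * vq^-1 ^+ i) = 0.
    by rewrite h mulr0.
  rewrite mulr_sumr (reindex_inj rev_ord_inj) /=.
  suff -> : (map_poly polyC_kk r).[vq] = \sum_(j < size p) vq ^+ (size p).-1 *
     ((map_poly polyC_kk p)`_(size p - j.+1) * vq^-1 ^+ (size p - j.+1)) by [].
  rewrite (@horner_coef_wide _ (size p)); last first.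
    by rewrite size_map_poly size_poly.
  apply: eq_bigr => j _; rewrite !coef_map /= coef_poly ltn_ord.
  have jp := ltn_ord j.
  have e : ((size p).-1 - j = size p - j.+1)%N.
    by rewrite -subn1 -subnDA add1n.
  rewrite e mulrCA; congr (_ * _).
  have -> : ((size p).-1 = j + (size p - j.+1))%N.
    by rewrite -e subnKC // -ltnS prednK // (leq_trans _ jp).
  by rewrite exprD -mulrA -exprMn mulfV ?vq_neq0 // expr1n mulr1.
apply/polyP => i; rewrite coef0.
have [ip|ip] := ltnP i (size p); last by rewrite nth_default.
have : r`_((size p).-1 - i) = 0 by rewrite r0 coef0.
have pK : ((size p).-1.+1 = size p)%N by rewrite prednK // (leq_trans _ ip).
have ip' : (i <= (size p).-1)%N by rewrite -ltnS pK.
have lt : ((size p).-1 - i < size p)%N by rewrite -[ltnRHS]pK ltnS leq_subr.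
by rewrite coef_poly lt subKn.
Qed.

Lemma ratio_kk (x : {ratio {poly rat}}) :
  (\pi_({fraction {poly rat}}) x : kk) = tofrac \n_x / tofrac \d_x.
Proof.
have xd : \d_x != 0 by exact: denom_ratioP.
rewrite -[in LHS](Ratio_numden x).
rewrite /FracField.tofrac -!lock /=.
rewrite /GRing.inv /= /GRing.mul /=.
rewrite -FracField.pi_inv -FracField.pi_mul /FracField.mulf /FracField.invf.
by rewrite !numden_Ratio ?oner_neq0 // ?mulr1 ?mul1r.
Qed.

Lemma kbarE (n d : {poly rat}) : d != 0 ->
  kbar (tofrac n / tofrac d) = evalV n / evalV d.
Proof.
move=> d0; rewrite /kbar /=.
pose x : {ratio {poly rat}} :=
  repr (tofrac n / tofrac d : {fraction {poly rat}}).
have fE : (tofrac n / tofrac d : kk) = tofrac \n_x / tofrac \d_x.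
  by rewrite -ratio_kk reprK.
have xd : \d_x != 0 by exact: denom_ratioP.
have : tofrac (n * \d_x) == tofrac (\n_x * d).
  by move/eqP: fE; rewrite eqr_div ?tofrac_eq0 // !rmorphM.
rewrite tofrac_eq => /eqP h.
by apply/eqP; rewrite -/x eqr_div ?evalV_eq0 // -!rmorphM h.
Qed.

Lemma kk_fracP (f : kk) :
  exists n d : {poly rat}, d != 0 /\ f = tofrac n / tofrac d.
Proof.
exists \n_(repr (f : {fraction {poly rat}})).
exists \d_(repr (f : {fraction {poly rat}})).
by split; [exact: denom_ratioP | rewrite -ratio_kk reprK].
Qed.

Lemma kbar_rmorph_subproof : zmod_morphism kbar * monoid_morphism kbar.
Proof.
have kbarD : {morph kbar : x y / x - y}.
  move=> f g; have [n [d [d0 ->]]] := kk_fracP f.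
  have [n' [d' [d'0 ->]]] := kk_fracP g.
  rewrite -mulNr addf_div ?tofrac_eq0 // -rmorphN -!rmorphM -rmorphD.
  rewrite !kbarE ?mulf_neq0 // -mulNr addf_div ?evalV_eq0 //.
  by rewrite rmorphD !rmorphM rmorphN.
have kbarM : {morph kbar : x y / x * y}.
  move=> f g; have [n [d [d0 ->]]] := kk_fracP f.
  have [n' [d' [d'0 ->]]] := kk_fracP g.
  by rewrite mulf_div -!rmorphM !kbarE ?mulf_neq0 // mulf_div !rmorphM.
split=> //; split=> //.
have -> : (1 : kk) = tofrac (1 : {poly rat}) / tofrac (1 : {poly rat}).
  by rewrite rmorph1 divr1.
by rewrite kbarE ?oner_neq0 // !rmorph1 divr1.
Qed.

HB.instance Definition _ :=
  GRing.isZmodMorphism.Build kk kk kbar kbar_rmorph_subproof.1.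
HB.instance Definition _ :=
  GRing.isMonoidMorphism.Build kk kk kbar kbar_rmorph_subproof.2.

Lemma kbar_vq : kbar vq = vq^-1.
Proof.
have e : vq = tofrac ('X : {poly rat}) / tofrac (1 : {poly rat}).
  by rewrite rmorph1 divr1.
rewrite {1}e kbarE ?oner_neq0 // rmorph1 divr1.
by rewrite /evalV map_polyX hornerX.
Qed.

(* <k>_x! with <s>_x = x^s - x^{-s}. *)
Definition qbracket (x : kk) (s : nat) : kk := x ^+ s - x ^- s.
Definition qfact (x : kk) (k : nat) : kk := \prod_(1 <= s < k.+1) qbracket x s.

Inductive ugen (I : Type) := GE of I | GF of I | GK of I | GKi of I.

(* Noncommutative algebra expressions over kk in the generators. *)
Inductive uexpr (I : Type) :=
  | UGen of ugen I
  | UZero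
  | UOne
  | UAdd of uexpr I & uexpr I
  | UMul of uexpr I & uexpr I
  | UScale of kk & uexpr I.

Arguments UZero {I}.
Arguments UOne {I}.

HB.instance Definition _ (I : Type) := gen_eqMixin (uexpr I).
HB.instance Definition _ (I : Type) := gen_choiceMixin (uexpr I).

Declare Scope uexpr_scope.
Delimit Scope uexpr_scope with U.
Bind Scope uexpr_scope with uexpr.
Notation "0" := (@UZero _) : uexpr_scope.
Notation "1" := (@UOne _) : uexpr_scope.
Notation "x + y" := (UAdd x y) : uexpr_scope.
Notation "x * y" := (UMul x y) : uexpr_scope.
Notation "c *: x" := (UScale c%R x) : uexpr_scope.
Notation "x - y" := (UAdd x (UScale (-1)%R y)) : uexpr_scope.
Notation "x ^+ n" := (iter n (UMul x) (@UOne _)) : uexpr_scope.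

Section QuantumGroup.
Variables (I : finType) (C : cartan_datum I).
Implicit Types i j : I.
Local Notation a := (cartan C).

Definition qi i : kk := qq ^+ symd C i.

Definition udivpow i (x : uexpr I) (k : nat) : uexpr I :=
  ((qfact (qi i) k)^-1 *: x ^+ k)%U.

Arguments udivpow : simpl never.

(* The quantum Serre expression, summed over r + s = 1 - a_ij; here a_ij <= 0 *)
(* as i != j, so that - a_ij is its absolute value.                           *)
Definition userre i j (x y : uexpr I) : uexpr I :=
  \big[@UAdd I/0%U]_(s < `|a i j|.+2)
     ((-1) ^+ s *: (udivpow i x (`|a i j|.+1 - s) * y * udivpow i x s))%U.

Inductive urel : uexpr I -> uexpr I -> Prop :=
  | URel_KKi i : urel (UGen (GK i) * UGen (GKi i))%U 1%U
  | URel_KiK i : urel (UGen (GKi i) * UGen (GK i))%U 1%U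
  | URel_KK i j :
      urel (UGen (GK i) * UGen (GK j))%U (UGen (GK j) * UGen (GK i))%U
  | URel_KE i j : urel (UGen (GK i) * UGen (GE j))%U
      (qi i ^ a i j *: (UGen (GE j) * UGen (GK i)))%U
  | URel_KF i j : urel (UGen (GK i) * UGen (GF j))%U
      (qi i ^ (- a i j) *: (UGen (GF j) * UGen (GK i)))%U
  | URel_EF i j :
      urel (UGen (GE i) * UGen (GF j) - UGen (GF j) * UGen (GE i))%U
      (((i == j)%:R * ((qi i)^-1 - qi i)) *: (UGen (GK i) - UGen (GKi i)))%U
  | URel_SerreE i j : i != j ->
      urel (userre i j (UGen (GE i)) (UGen (GE j))) 0%U
  | URel_SerreF i j : i != j ->
      urel (userre i j (UGen (GF i)) (UGen (GF j))) 0%U.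

(* The least congruence containing the relations whose quotient is a unital   *)
(* associative kk-algebra.                                                    *)
Inductive ucong : uexpr I -> uexpr I -> Prop :=
  | UC_rel x y : urel x y -> ucong x y
  | UC_refl x : ucong x x
  | UC_sym x y : ucong x y -> ucong y x
  | UC_trans x y z : ucong x y -> ucong y z -> ucong x z
  | UC_add x x' y y' : ucong x x' -> ucong y y' -> ucong (x + y)%U (x' + y')%U
  | UC_mul x x' y y' : ucong x x' -> ucong y y' -> ucong (x * y)%U (x' * y')%U
  | UC_scale c x x' : ucong x x' -> ucong (c *: x)%U (c *: x')%U
  | UC_addA x y z : ucong (x + (y + z))%U (x + y + z)%U
  | UC_addC x y : ucong (x + y)%U (y + x)%U
  | UC_add0 x : ucong (0 + x)%U x
  | UC_addN x : ucong (-1 *: x + x)%U 0%U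
  | UC_mulA x y z : ucong (x * (y * z))%U (x * y * z)%U
  | UC_mul1l x : ucong (1 * x)%U x
  | UC_mul1r x : ucong (x * 1)%U x
  | UC_mulDl x y z : ucong ((x + y) * z)%U (x * z + y * z)%U
  | UC_mulDr x y z : ucong (x * (y + z))%U (x * y + x * z)%U
  | UC_scaleA c d x : ucong (c *: (d *: x))%U ((c * d) *: x)%U
  | UC_scale1 x : ucong (1 *: x)%U x
  | UC_scaleDr c x y : ucong (c *: (x + y))%U (c *: x + c *: y)%U
  | UC_scaleDl c d x : ucong ((c + d) *: x)%U (c *: x + d *: x)%U
  | UC_scaleAl c x y : ucong (c *: (x * y))%U ((c *: x) * y)%U
  | UC_scaleAr c x y : ucong (c *: (x * y))%U (x * (c *: y))%U.

Definition ucongb (x y : uexpr I) : bool := `[< ucong x y >].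

Lemma ucongb_equiv : equiv_class_of ucongb.
Proof.
split=> [x|x y|y x z].
- by apply/asboolP; exact: UC_refl.
- by apply/asboolP/asboolP => h; exact: UC_sym.
- by move=> /asboolP h /asboolP h'; apply/asboolP; exact: UC_trans h h'.
Qed.

Canonical ucong_equiv := EquivRelPack ucongb_equiv.

Definition Uq := {eq_quot ucongb}.

HB.instance Definition _ := Choice.on Uq.
HB.instance Definition _ := EqQuotient.on Uq.

Definition uclass (x : uexpr I) : Uq := \pi_Uq x.

Lemma uclassP x y : uclass x = uclass y <-> ucong x y.
Proof.
by split=> [/eqmodP/asboolP|h] //; apply/eqmodP/asboolP.
Qed.

Lemma uclassW (P : Uq -> Prop) : (forall x, P (uclass x)) -> forall u, P u.
Proof. by move=> h u; rewrite -[u](@reprK _ Uq); exact: h. Qed.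

Lemma urepr x : ucong (repr (uclass x)) x.
Proof. by apply/uclassP; rewrite /uclass reprK. Qed.

Definition uadd (u v : Uq) := uclass (repr u + repr v)%U.
Definition umul (u v : Uq) := uclass (repr u * repr v)%U.
Definition uscale (c : kk) (u : Uq) := uclass (c *: repr u)%U.

Lemma uaddE x y : uadd (uclass x) (uclass y) = uclass (x + y)%U.
Proof. by apply/uclassP/UC_add; exact: urepr. Qed.
Lemma umulE x y : umul (uclass x) (uclass y) = uclass (x * y)%U.
Proof. by apply/uclassP/UC_mul; exact: urepr. Qed.
Lemma uscaleE c x : uscale c (uclass x) = uclass (c *: x)%U.
Proof. by apply/uclassP/UC_scale; exact: urepr. Qed.

Fact uaddA : associative uadd.
Proof.
elim/uclassW=> x; elim/uclassW=> y; elim/uclassW=> z.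
by rewrite !uaddE; apply/uclassP/UC_addA.
Qed.
Fact uaddC : commutative uadd.
Proof.
by elim/uclassW=> x; elim/uclassW=> y; rewrite !uaddE; apply/uclassP/UC_addC.
Qed.
Fact uadd0 : left_id (uclass 0%U) uadd.
Proof. by elim/uclassW=> x; rewrite uaddE; apply/uclassP/UC_add0. Qed.
Fact uaddN : left_inverse (uclass 0%U) (uscale (-1)) uadd.
Proof. by elim/uclassW=> x; rewrite uscaleE uaddE; apply/uclassP/UC_addN. Qed.

HB.instance Definition _ := GRing.isZmodule.Build Uq uaddA uaddC uadd0 uaddN.

Fact umulA : associative umul.
Proof.
elim/uclassW=> x; elim/uclassW=> y; elim/uclassW=> z.
by rewrite !umulE; apply/uclassP/UC_mulA.
Qed.
Fact umul1l : left_id (uclass 1%U) umul.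
Proof. by elim/uclassW=> x; rewrite umulE; apply/uclassP/UC_mul1l. Qed.
Fact umul1r : right_id (uclass 1%U) umul.
Proof. by elim/uclassW=> x; rewrite umulE; apply/uclassP/UC_mul1r. Qed.
Fact umulDl : left_distributive umul uadd.
Proof.
elim/uclassW=> x; elim/uclassW=> y; elim/uclassW=> z.
by rewrite !(uaddE, umulE); apply/uclassP/UC_mulDl.
Qed.
Fact umulDr : right_distributive umul uadd.
Proof.
elim/uclassW=> x; elim/uclassW=> y; elim/uclassW=> z.
by rewrite !(uaddE, umulE); apply/uclassP/UC_mulDr.
Qed.

(* The counit, which shows that the quotient is not the zero algebra. *)
Fixpoint ucounit (x : uexpr I) : kk :=
  match x with
  | UGen (GE _) | UGen (GF _) | UZero => 0
  | UGen (GK _) | UGen (GKi _) | UOne => 1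
  | UAdd y z => ucounit y + ucounit z
  | UMul y z => ucounit y * ucounit z
  | UScale c y => c * ucounit y
  end.

Lemma ucounit_serre i j x y : ucounit y = 0 -> ucounit (userre i j x y) = 0.
Proof.
move=> y0; rewrite /userre (big_morph ucounit (id1 := 0) (op1 := +%R)) //.
by rewrite big1 // => s _ /=; rewrite y0 !(mulr0, mul0r).
Qed.

Lemma ucounit_cong x y : ucong x y -> ucounit x = ucounit y.
Proof.
elim=> //=; try by intros; congruence.
- move=> {}x {}y [] //= *; rewrite ?ucounit_serre //;
  by rewrite !(mulr0, mul0r, mulr1, mulrN, addr0, subrr, oppr0).
- by move=> *; rewrite addrA.
- by move=> *; rewrite addrC.
- by move=> *; rewrite add0r.
- by move=> *; rewrite mulN1r addNr.
- by move=> *; rewrite mulrA.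
- by move=> *; rewrite mul1r.
- by move=> *; rewrite mulr1.
- by move=> *; rewrite mulrDl.
- by move=> *; rewrite mulrDr.
- by move=> *; rewrite mulrA.
- by move=> *; rewrite mul1r.
- by move=> *; rewrite mulrDr.
- by move=> *; rewrite mulrDl.
- by move=> *; rewrite mulrA.
- by move=> *; rewrite mulrCA.
Qed.

Fact uone_neq0 : uclass 1%U != 0.
Proof.
apply/eqP => /uclassP /ucounit_cong /= /eqP.
by rewrite oner_eq0.
Qed.

HB.instance Definition _ := GRing.Zmodule_isNzRing.Build Uq
  umulA umul1l umul1r umulDl umulDr uone_neq0.

Fact uscaleA c d u : uscale c (uscale d u) = uscale (c * d) u.
Proof. by elim/uclassW: u => x; rewrite !uscaleE; apply/uclassP/UC_scaleA. Qed.
Fact uscale1 : left_id 1 uscale.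
Proof. by elim/uclassW=> x; rewrite uscaleE; apply/uclassP/UC_scale1. Qed.
Fact uscaleDr : right_distributive uscale uadd.
Proof.
move=> c; elim/uclassW=> x; elim/uclassW=> y.
by rewrite uaddE !uscaleE uaddE; apply/uclassP/UC_scaleDr.
Qed.
Fact uscaleDl u c d : uscale (c + d) u = uadd (uscale c u) (uscale d u).
Proof.
by elim/uclassW: u => x; rewrite !uscaleE uaddE; apply/uclassP/UC_scaleDl.
Qed.

HB.instance Definition _ := GRing.Zmodule_isLmodule.Build kk Uq
  uscaleA uscale1 uscaleDr uscaleDl.

Fact uscaleAl c (u v : Uq) : c *: (u * v) = (c *: u) * v.
Proof.
elim/uclassW: u => x; elim/uclassW: v => y; rewrite /GRing.scale /= /GRing.mul /=.
by rewrite !(uscaleE, umulE); apply/uclassP/UC_scaleAl.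
Qed.
HB.instance Definition _ := GRing.Lmodule_isLalgebra.Build kk Uq uscaleAl.

Fact uscaleAr c (u v : Uq) : c *: (u * v) = u * (c *: v).
Proof.
elim/uclassW: u => x; elim/uclassW: v => y; rewrite /GRing.scale /= /GRing.mul /=.
by rewrite !(uscaleE, umulE); apply/uclassP/UC_scaleAr.
Qed.
HB.instance Definition _ := GRing.Lalgebra_isAlgebra.Build kk Uq uscaleAr.

Definition uE i : Uq := uclass (UGen (GE i)).
Definition uF i : Uq := uclass (UGen (GF i)).
Definition uK i : Uq := uclass (UGen (GK i)).
Definition uKi i : Uq := uclass (UGen (GKi i)).

Lemma uclassD x y : uclass (x + y)%U = uclass x + uclass y.
Proof. by rewrite -uaddE. Qed.
Lemma uclassM x y : uclass (x * y)%U = uclass x * uclass y.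
Proof. by rewrite -umulE. Qed.
Lemma uclassZ c x : uclass (c *: x)%U = c *: uclass x.
Proof. by rewrite -uscaleE. Qed.
Lemma uclassXn x n : uclass (x ^+ n)%U = uclass x ^+ n.
Proof. by elim: n => //= n IH; rewrite uclassM IH exprS. Qed.
Lemma uclassB x y : uclass (x - y)%U = uclass x - uclass y.
Proof. by rewrite uclassD uclassZ scaleN1r. Qed.

Definition divpow i (x : Uq) (k : nat) : Uq := (qfact (qi i) k)^-1 *: x ^+ k.

Lemma uclass_serre i j x y : uclass (userre i j x y) =
  \sum_(s < `|a i j|.+2) (-1) ^+ s *:
    (divpow i (uclass x) (`|a i j|.+1 - s) * uclass y * divpow i (uclass x) s).
Proof.
rewrite /userre (big_morph uclass (id1 := 0) (op1 := +%R)) //; last exact: uclassD.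
by apply: eq_bigr => s _; rewrite uclassZ !uclassM !uclassZ !uclassXn.
Qed.

Lemma uKKi i : uK i * uKi i = 1.
Proof. by rewrite -uclassM; apply/uclassP/UC_rel/URel_KKi. Qed.

Lemma uKiK i : uKi i * uK i = 1.
Proof. by rewrite -uclassM; apply/uclassP/UC_rel/URel_KiK. Qed.

Lemma uKK i j : uK i * uK j = uK j * uK i.
Proof. by rewrite -!uclassM; apply/uclassP/UC_rel/URel_KK. Qed.

Lemma uKE i j : uK i * uE j = qi i ^ a i j *: (uE j * uK i).
Proof. by rewrite -!uclassM -uclassZ; apply/uclassP/UC_rel/URel_KE. Qed.

Lemma uKF i j : uK i * uF j = qi i ^ (- a i j) *: (uF j * uK i).
Proof. by rewrite -!uclassM -uclassZ; apply/uclassP/UC_rel/URel_KF. Qed.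

Lemma uEF i j : uE i * uF j - uF j * uE i =
  ((i == j)%:R * ((qi i)^-1 - qi i)) *: (uK i - uKi i).
Proof.
by rewrite -!uclassM -!uclassB -uclassZ; apply/uclassP/UC_rel/URel_EF.
Qed.

Lemma userreE i j : i != j ->
  \sum_(s < `|a i j|.+2) (-1) ^+ s *:
    (divpow i (uE i) (`|a i j|.+1 - s) * uE j * divpow i (uE i) s) = 0.
Proof. by move=> ij; rewrite -uclass_serre; apply/uclassP/UC_rel/URel_SerreE. Qed.

Lemma userreF i j : i != j ->
  \sum_(s < `|a i j|.+2) (-1) ^+ s *:
    (divpow i (uF i) (`|a i j|.+1 - s) * uF j * divpow i (uF i) s) = 0.
Proof. by move=> ij; rewrite -uclass_serre; apply/uclassP/UC_rel/URel_SerreF. Qed.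

(* On expressions: fix the generators, reverse products, conjugate scalars.   *)
Fixpoint ubar_expr (x : uexpr I) : Uq :=
  match x with
  | UGen g => uclass (UGen g)
  | UZero => 0
  | UOne => 1
  | UAdd y z => ubar_expr y + ubar_expr z
  | UMul y z => ubar_expr z * ubar_expr y
  | UScale c y => kbar c *: ubar_expr y
  end.

Definition ubar (u : Uq) : Uq := ubar_expr (repr u).

Lemma qq_neq0 : qq != 0.
Proof. by rewrite expf_neq0 ?vq_neq0. Qed.

Lemma qi_neq0 i : qi i != 0.
Proof. by rewrite expf_neq0 ?qq_neq0. Qed.

Lemma kbar_qi i : kbar (qi i) = (qi i)^-1.
Proof. by rewrite /qi /qq !rmorphXn /= kbar_vq !exprVn. Qed.

Lemma kbar_qfact i k : kbar (qfact (qi i) k) = (-1) ^+ k * qfact (qi i) k.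
Proof.
rewrite /qfact rmorph_prod /= (eq_bigr (fun s => -1 * qbracket (qi i) s)).
  by rewrite big_split /= prodr_const_nat subn1.
move=> s _; rewrite /qbracket rmorphB /= fmorphV /= !(rmorphXn _ s (qi i)) /=. rewrite kbar_qi.
by rewrite exprVn invrK mulN1r opprB.
Qed.

Lemma ubar_expr_Xn x n : ubar_expr (x ^+ n)%U = ubar_expr x ^+ n.
Proof. by elim: n => //= n ->; rewrite exprSr. Qed.

Lemma ubar_divpow i x k : ubar_expr (udivpow i x k) =
  (-1) ^+ k *: divpow i (ubar_expr x) k.
Proof.
rewrite /udivpow [LHS]/= ubar_expr_Xn /divpow scalerA fmorphV /= kbar_qfact.
by rewrite invfM -exprVn invrN1.
Qed.

Lemma ubar_serre i j x y :
  ubar_expr (userre i j x y) = \sum_(s < `|a i j|.+2) (-1) ^+ s *: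
    (divpow i (ubar_expr x) (`|a i j|.+1 - s) * ubar_expr y *
       divpow i (ubar_expr x) s).
Proof.
set N := `|a i j|.+1; rewrite /userre -/N.
rewrite (big_morph ubar_expr (id1 := 0) (op1 := +%R)) //.
rewrite (reindex_inj rev_ord_inj); apply: eq_bigr => s _.
have sN : (s <= N)%N by rewrite -ltnS.
cbv beta; rewrite (_ : nat_of_ord (rev_ord s) = N - s)%N; last exact: subSS.
rewrite (subKn sN).
rewrite -[LHS]/(kbar ((-1) ^+ (N - s)) *: (ubar_expr (udivpow i x (N - s)) *
  (ubar_expr y * ubar_expr (udivpow i x s)))).
rewrite !ubar_divpow rmorphXn rmorphN1 mulrA.
rewrite -!scalerAr -!scalerAl !scalerA; congr (_ *: _).
by rewrite mulrACA -expr2 -exprM mulnC exprM sqrrN !expr1n mul1r.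
Qed.

Lemma ubar_cong x y : ucong x y -> ubar_expr x = ubar_expr y.
Proof.
elim=> //=; try by intros; congruence.
- move=> {}x {}y [] /=.
  + by move=> i; rewrite uKiK.
  + by move=> i; rewrite uKKi.
  + by move=> i j; rewrite uKK.
  + move=> i j; rewrite -!/(uE _) -!/(uK _) uKE scalerA.
    by rewrite fmorphXz /= kbar_qi -expfV mulVf ?scale1r //
      expfz_neq0 ?qi_neq0.
  + move=> i j; rewrite -!/(uF _) -!/(uK _) uKF scalerA.
    by rewrite fmorphXz /= kbar_qi -expfV mulVf ?scale1r //
      expfz_neq0 ?qi_neq0.
  + move=> i j; rewrite -!/(uF _) -!/(uE _) -!/(uK _) -!/(uKi _).
    rewrite !rmorphN1 !scaleN1r -[LHS]opprB uEF.
    rewrite rmorphM rmorph_nat rmorphB /= fmorphV /= kbar_qi invrK.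
    by rewrite -scaleNr -mulrN opprB.
  + by move=> i j ij; rewrite ubar_serre; exact: userreE.
  + by move=> i j ij; rewrite ubar_serre; exact: userreF.
- by move=> *; rewrite addrA.
- by move=> *; rewrite addrC.
- by move=> *; rewrite add0r.
- by move=> *; rewrite rmorphN1 scaleN1r addNr.
- by move=> *; rewrite mulrA.
- by move=> *; rewrite mulr1.
- by move=> *; rewrite mul1r.
- by move=> *; rewrite mulrDr.
- by move=> *; rewrite mulrDl.
- by move=> *; rewrite scalerA rmorphM.
- by move=> *; rewrite rmorph1 scale1r.
- by move=> *; rewrite scalerDr.
- by move=> *; rewrite rmorphD scalerDl.
- by move=> *; rewrite scalerAr.
- by move=> *; rewrite scalerAl.
Qed.

Lemma ubarE x : ubar (uclass x) = ubar_expr x.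
Proof. by apply/ubar_cong/urepr. Qed.

(* ubar is the anti-linear anti-homomorphism fixing all generators.           *)
Lemma ubarD : {morph ubar : u v / u + v}.
Proof.
by elim/uclassW=> x; elim/uclassW=> y; rewrite -uclassD !ubarE.
Qed.

Lemma ubar1 : ubar 1 = 1.
Proof. exact: (ubarE 1%U). Qed.

Lemma ubarM u v : ubar (u * v) = ubar v * ubar u.
Proof.
by elim/uclassW: u => x; elim/uclassW: v => y; rewrite -uclassM !ubarE.
Qed.

Lemma ubarZ c u : ubar (c *: u) = kbar c *: ubar u.
Proof. by elim/uclassW: u => x; rewrite -uclassZ !ubarE. Qed.

Lemma ubar_gen g : ubar (uclass (UGen g)) = uclass (UGen g).
Proof. exact: ubarE. Qed.

End QuantumGroup.

Section Weyl.
Variables (I : finType) (C : cartan_datum I).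
Implicit Types i j : I.
Local Notation a := (cartan C).

Definition root_lattice := {ffun I -> int}.

Definition simple_root i : root_lattice := [ffun j => (i == j)%:Z].

Definition root_form (x y : root_lattice) : int :=
  \sum_i \sum_j x i * y j * ((symd C i)%:Z * a i j).

(* The linear extension of s_i(alpha_j) = alpha_j - a_ij alpha_i. *)
Definition simple_refl i (x : root_lattice) : root_lattice :=
  x - simple_root i *~ \sum_j x j * a i j.

Definition refl_word (s : seq I) : root_lattice -> root_lattice :=
  foldr (fun i f => simple_refl i \o f) id s.

Lemma simple_refl_root i j :
  simple_refl i (simple_root j) = simple_root j - simple_root i *~ a i j.
Proof.
congr (_ - _ *~ _); rewrite (bigD1 j) //= ffunE eqxx mul1r big1 ?addr0 // => l lj.
by rewrite ffunE eq_sym (negbTE lj) mul0r.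
Qed.

Lemma simple_reflK i : involutive (simple_refl i).
Proof.
move=> x; rewrite {1}/simple_refl; set c := \sum_j x j * a i j.
suff -> : \sum_j simple_refl i x j * a i j = - c.
  by rewrite /simple_refl -/c mulrNz opprK subrK.
have rE j : simple_refl i x j = x j - (i == j)%:Z * c.
  rewrite /simple_refl -/c !ffunE; congr (_ - _).
  have -> : (simple_root i *~ c) j = (simple_root i j) *~ c.
    case: c => n; first by rewrite -!pmulrn ffunMnE.
    by rewrite NegzE !mulrNz ffunE -!pmulrn ffunMnE.
  by rewrite ffunE mulrzz.
under eq_bigr do rewrite rE mulrBl.
rewrite big_split /= -/c sumrN (bigD1 i) //= eqxx mul1r big1.
  by rewrite addr0 cartan_diag; ring.
by move=> j ji; rewrite eq_sym (negbTE ji) !mul0r.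
Qed.

Lemma refl_word_cat s t : refl_word (s ++ t) = refl_word s \o refl_word t.
Proof. by elim: s => //= i s ->. Qed.

Lemma refl_wordK s : refl_word (rev s) \o refl_word s = id.
Proof.
elim: s => //= i s IH; rewrite rev_cons -cats1 refl_word_cat /=.
apply/funext => x /=; rewrite simple_reflK.
exact: (congr1 (fun f => f x) IH).
Qed.

Lemma refl_wordKV s : refl_word s \o refl_word (rev s) = id.
Proof. by rewrite -{1}(revK s) refl_wordK. Qed.

Definition in_weyl (f : root_lattice -> root_lattice) : bool :=
  `[< exists s, f = refl_word s >].

Definition weyl := {f : root_lattice -> root_lattice | in_weyl f}.
HB.instance Definition _ := [Choice of weyl by <:].
HB.instance Definition _ := SubType.on weyl.

Lemma refl_word_in_weyl s : in_weyl (refl_word s).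
Proof. by apply/asboolP; exists s. Qed.

Definition weyl_of_word (s : seq I) : weyl :=
  exist (fun f => in_weyl f) _ (refl_word_in_weyl s).

Lemma weyl_wordP (w : weyl) : exists s, w = weyl_of_word s.
Proof.
by have /asboolP[s ws] := valP w; exists s; apply/val_inj.
Qed.

Fact weyl_mul_subproof (w w' : weyl) : in_weyl (val w \o val w').
Proof.
have [s ->] := weyl_wordP w; have [s' ->] := weyl_wordP w'.
by rewrite /= -refl_word_cat refl_word_in_weyl.
Qed.

Definition weyl_one : weyl := weyl_of_word [::].
Definition weyl_mul (w w' : weyl) : weyl :=
  exist (fun f => in_weyl f) _ (weyl_mul_subproof w w').
Definition weyl_inv (w : weyl) : weyl :=
  weyl_of_word (rev (projT1 (cid (weyl_wordP w)))).

Fact weyl_mulA : associative weyl_mul.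
Proof. by move=> u v w; apply/val_inj. Qed.
Fact weyl_mul1g : left_id weyl_one weyl_mul.
Proof. by move=> w; apply/val_inj. Qed.
Fact weyl_mulg1 : right_id weyl_one weyl_mul.
Proof. by move=> w; apply/val_inj. Qed.
Fact weyl_mulVg : left_inverse weyl_one weyl_inv weyl_mul.
Proof.
move=> w; apply/val_inj; rewrite /= /weyl_inv; case: cid => s /= ws.
by rewrite {1}ws /= refl_wordK.
Qed.
Fact weyl_mulgV : right_inverse weyl_one weyl_inv weyl_mul.
Proof.
move=> w; apply/val_inj; rewrite /= /weyl_inv; case: cid => s /= ws.
by rewrite {1}ws /= refl_wordKV.
Qed.

HB.instance Definition _ := isGroup.Build weyl
  weyl_mulA weyl_mul1g weyl_mulg1 weyl_mulVg weyl_mulgV.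

Lemma weyl_length_subproof (w : weyl) :
  exists n, `[< exists s, size s = n /\ w = weyl_of_word s >].
Proof.
by have [s ws] := weyl_wordP w; exists (size s); apply/asboolP; exists s.
Qed.

Definition weyl_length (w : weyl) : nat := ex_minn (weyl_length_subproof w).

Definition reduced_words (w : weyl) : set ((weyl_length w).-tuple I) :=
  [set s | weyl_of_word s = w].

End Weyl.

Arguments reduced_words {I C} w.

Section Braid.
Variables (I : finType) (C : cartan_datum I).
Implicit Types i j : I.
Local Notation a := (cartan C).
Local Notation U := (Uq C).

Definition uKz i (m : int) : U :=
  match m with
  | Posz n => uK C i ^+ n
  | Negz n => uKi C i ^+ n.+1
  end.

(* The common shape of T_i(E_j) and T_i(F_j), j != i, summed over             *)
(* r + s = - a_ij; the scalar is q_i^{s + a_ij / 2}, written as a power of    *)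
(* q^{1/2}.                                                                   *)
Definition braid_sum i j (x y : U) : U :=
  \sum_(r < `|a i j|.+1) let s := (`|a i j| - r)%N in
    ((-1) ^+ r * vq ^ ((symd C i)%:Z * (s%:Z *+ 2 + a i j))) *:
      (divpow i x r * y * divpow i x s).

(* T is the automorphism T_i of U_q(g); its values on the generators          *)
(* determine it.                                                              *)
Record is_braid_aut i (T : U -> U) : Prop := IsBraidAut {
  braid_bij : bijective T;
  braid_K : forall j, T (uK C j) = uK C j * uKz i (- a i j);
  braid_Ei : T (uE C i) = (qi C i)^-1 *: (uKi C i * uF C i);
  braid_Fi : T (uF C i) = (qi C i)^-1 *: (uK C i * uE C i);
  braid_E : forall j, j != i -> T (uE C j) = braid_sum i j (uE C i) (uE C j);
  braid_F : forall j, j != i -> T (uF C j) = braid_sum i j (uF C i) (uF C j)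
}.

Variable T : I -> U -> U.

Definition braid_word (s : seq I) : U -> U :=
  foldr (fun i f => T i \o f) id s.

Section Word.
Variables (m : nat) (s : m.-tuple I).

Definition root_vector (k : 'I_m) : U :=
  braid_word (take k s) (uE C (tnth s k)).

Definition root_of (k : 'I_m) : root_lattice I :=
  refl_word C (take k s) (simple_root (tnth s k)).

Definition pbw_monomial (b : m.-tuple nat) : U :=
  vq ^ (\sum_(k < m) \sum_(l < m | (k < l)%N)
          root_form C (root_of k) (root_of l) * (tnth b k * tnth b l)%N%:Z)
    *: \prod_(k < m) root_vector k ^+ tnth b k.

(* The Z[q^{1/2}, q^{-1/2}]-subalgebra generated by the root vectors: scaling *)
(* by q^{1/2} and q^{-1/2} together with additive inverses gives scaling by   *)
(* all of Z[q^{1/2}, q^{-1/2}].                                               *)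
Inductive UA : U -> Prop :=
  | UA_gen k : UA (root_vector k)
  | UA_1 : UA 1
  | UA_sub x y : UA x -> UA y -> UA (x - y)
  | UA_mul x y : UA x -> UA y -> UA (x * y)
  | UA_vq x : UA x -> UA (vq *: x)
  | UA_vqV x : UA x -> UA (vq^-1 *: x).

(* x lies in the sum of the q^{-1} Z[q^{-1}] X_i^{a'} over a' != b. *)
Definition lower_span (b : m.-tuple nat) (x : U) : Prop :=
  exists (r : seq (m.-tuple nat)) (c : m.-tuple nat -> {poly int}),
    x = \sum_(b' <- r | b' != b)
          (qq^-1 * (map_poly intr (c b')).[qq^-1]) *: pbw_monomial b'.

Definition is_dual_canonical (b : m.-tuple nat) (x : U) : Prop :=
  [/\ UA x, ubar x = x & lower_span b (x - pbw_monomial b)].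

End Word.

(* For each reduced word s and each b there is exactly one x such that        *)
(* is_dual_canonical s b x, and the set of these x does not depend on s, so   *)
(* that the union over the reduced words of w is the set for any one of them. *)
Definition dual_canonical_basis (w : weyl C) : set U :=
  [set x | exists2 s, reduced_words w s &
     exists b : (weyl_length w).-tuple nat, is_dual_canonical s b x].

End Braid.

(* Main.v *)
(* Concatenating reduced words s of w and s' of w' gives a reduced word of    *)
(* ww' whose root vectors are those of s followed by the images under T_s of  *)
(* those of s'. The monomial with exponent b for s is thus the one with       *)
(* exponent (b, 0) for the concatenation, and T_s sends the monomial with     *)
(* exponent b for s' to the one with exponent (0, b), the q-powers agreeing   *)
(* because the form is W-invariant. The defining conditions of the basis      *)
(* carry over; bar-invariance does because each T_i commutes with bar.        *)

Require Import Defs.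
From mathcomp Require Import all_boot all_order all_algebra.
From mathcomp Require Import ring.
From mathcomp Require Import boolp classical_sets.

Set Implicit Arguments.
Unset Strict Implicit.
Unset Printing Implicit Defensive.

Import Order.TTheory GRing.Theory Num.Theory.
Local Open Scope ring_scope.
Local Open Scope classical_set_scope.

(** Membership in [dual_canonical_basis] of ww' can be witnessed by any one reduced word, and a
    concatenation of reduced words s of w and t of w' serves. Both inclusions then transport the
    three conditions of [is_dual_canonical] along a linear map, the identity or T_s, that sends PBW
    monomials to PBW monomials with zero-padded exponents ([pbw_monomial_pad_right],
    [pbw_monomial_pad_left]); triangularity follows by [lower_span_map]. Two computations carry T_s:
    the form is W-invariant ([root_form_refl_word]), which matches the q-powers, and T_i commutes
    with bar ([ubar_braid]), because its normalization makes the images of the generators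
    bar-invariant. *)

(** * Weyl group invariance of the form *)

(** Symmetry of $(d_i a_{ij})$ exposes the coroot pairings $\sum_j x_j a_{ij}$ that also define the
    reflections. *)
Lemma root_formE (I : finType) (C : cartan_datum I) (x y : root_lattice I) :
  root_form C x y =
    \sum_i y i * ((symd C i)%:Z * \sum_j x j * cartan C i j).
Proof.
rewrite /root_form exchange_big; apply: eq_bigr => i _ /=.
rewrite !mulr_sumr; apply: eq_bigr => j _.
by rewrite (symdP C j i); ring.
Qed.

Lemma simple_reflE (I : finType) (C : cartan_datum I) i (x : root_lattice I) k :
  simple_refl C i x k = x k - (i == k)%:Z * \sum_j x j * cartan C i j.
Proof.
rewrite /simple_refl; set c := \sum_j _; rewrite !ffunE; congr (_ - _).
transitivity ((simple_root i k) *~ c); last by rewrite ffunE mulrzz.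
case: c => n; first by rewrite -!pmulrn ffunMnE.
by rewrite NegzE !mulrNz ffunE -!pmulrn ffunMnE.
Qed.

Lemma root_form_simple_refl (I : finType) (C : cartan_datum I) i
    (x y : root_lattice I) :
  root_form C (simple_refl C i x) (simple_refl C i y) = root_form C x y.
Proof.
pose c (z : root_lattice I) k : int := \sum_j z j * cartan C k j.
have cE z k : c (simple_refl C i z) k = c z k - cartan C k i * c z i.
  rewrite /c; under eq_bigr do rewrite simple_reflE mulrBl.
  rewrite big_split /= sumrN; congr (_ - _).
  move: (\sum_j z j * cartan C i j) => t.
  rewrite (bigD1 i) //= eqxx mul1r big1 ?addr0 1?mulrC // => j ji.
  by rewrite eq_sym (negbTE ji) !mul0r.
rewrite !root_formE -!/(c _ _).
under eq_bigr => k _ do rewrite -/(c _ k) cE simple_reflE -/(c y i).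
under [RHS]eq_bigr => k _ do rewrite -/(c _ k).
(* Since $a_{ii} = 2$, the two subtracted sums are $d_i\,c(x,i)\,c(y,i)$ and its negative, so they
   cancel. *)
transitivity (\sum_k (y k * ((symd C k)%:Z * c x k)
   - (y k * cartan C i k) * ((symd C i)%:Z * c x i)
   - (i == k)%:Z * c y i * ((symd C k)%:Z * (c x k - cartan C k i * c x i)))).
  apply: eq_bigr => k _.
  have -> : y k * cartan C i k * ((symd C i)%:Z * c x i) =
      y k * ((symd C i)%:Z * cartan C i k) * c x i by ring.
  by rewrite symdP; ring.
rewrite !big_split /= !sumrN -mulr_suml -/(c y i).
rewrite [X in _ - X](bigD1 i) //= eqxx mul1r [X in _ - (_ + X)]big1.
  by rewrite cartan_diag; ring.
by move=> j ji; rewrite eq_sym (negbTE ji) !mul0r.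
Qed.

Lemma root_form_refl_word (I : finType) (C : cartan_datum I) s
    (x y : root_lattice I) :
  root_form C (refl_word C s x) (refl_word C s y) = root_form C x y.
Proof. by elim: s => //= i s IH; rewrite root_form_simple_refl. Qed.

(** * Compatibility of bar with the braid operators *)

Lemma ubar0 (I : finType) (C : cartan_datum I) : ubar (0 : Uq C) = 0.
Proof. by apply: (addrI (ubar (0 : Uq C))); rewrite -ubarD !addr0. Qed.

Lemma ubar_sum (I : finType) (C : cartan_datum I) n (F : 'I_n -> Uq C) :
  ubar (\sum_i F i) = \sum_i ubar (F i).
Proof. exact: (big_morph (@ubar I C) (@ubarD I C) (@ubar0 I C)). Qed.

Lemma ubarX (I : finType) (C : cartan_datum I) (u : Uq C) n :
  ubar (u ^+ n) = ubar u ^+ n.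
Proof. by elim: n => [|n IH]; rewrite ?ubar1 // exprS ubarM IH exprSr. Qed.

(** Bar negates each of the k factors $\langle s\rangle_{q_i}$ of the factorial. *)
Lemma ubar_divpowE (I : finType) (C : cartan_datum I) i (u : Uq C) k :
  ubar (divpow i u k) = (-1) ^+ k *: divpow i (ubar u) k.
Proof.
rewrite /divpow ubarZ ubarX scalerA fmorphV /= kbar_qfact.
by rewrite invfM -exprVn invrN1.
Qed.

Lemma kbar_vqXz (n : int) : kbar (vq ^ n) = vq ^ (- n).
Proof. by rewrite fmorphXz /= kbar_vq exprz_inv. Qed.

(* Bar exchanges the summands r and s = - a_ij - r. *)
Lemma ubar_braid_sum (I : finType) (C : cartan_datum I) i j (x y : Uq C) :
  i != j -> ubar x = x -> ubar y = y ->
  ubar (braid_sum i j x y) = braid_sum i j x y.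
Proof.
move=> ij xb yb; rewrite /braid_sum ubar_sum (reindex_inj rev_ord_inj).
apply: eq_bigr => r _ /=.
have rN : (r <= `|cartan C i j|)%N by rewrite -ltnS.
rewrite subSS subKn // ubarZ !ubarM !ubar_divpowE xb yb.
rewrite -!scalerAl -!scalerAr !scalerA mulrA; congr (_ *: _).
rewrite rmorphM rmorphXn rmorphN1 /= kbar_vqXz.
(* Exchanging r and s negates the exponent, as $r + s = -a_{ij}$. *)
have -> : - ((symd C i)%:Z * (r%:Z *+ 2 + cartan C i j)) =
   (symd C i)%:Z * ((`|cartan C i j| - r)%N%:Z *+ 2 + cartan C i j).
  rewrite -subzn // abszE ler0_norm ?cartan_off //.
  by move: (nat_of_ord r) => n; ring.
set e := vq ^ _; set m := (_ - r)%N.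
(* The sign $(-1)^m$ occurs twice, in the coefficient and from a divided power, so only $(-1)^r$
   survives. *)
have regroup (u v x' y' : kk) : u * u = 1 ->
    u * e * (v * x') * (u * y') = v * e * x' * y'.
  by move=> u1; rewrite -[RHS]mul1r -u1; ring.
by apply: regroup; rewrite -expr2 sqrr_sign.
Qed.

Lemma uK_uKz (I : finType) (C : cartan_datum I) j i n :
  uK C j * uKz C i n = uKz C i n * uK C j.
Proof.
have cK : GRing.comm (uK C j) (uK C i) by exact: uKK.
have cKi : GRing.comm (uK C j) (uKi C i).
  rewrite /GRing.comm -[LHS]mul1r -(uKiK C i) -mulrA [uK C i * _]mulrA -uKK.
  by rewrite -!mulrA uKKi mulr1.
by case: n => n; apply: commrX.
Qed.

Lemma ubar_uKz (I : finType) (C : cartan_datum I) i n :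
  ubar (uKz C i n) = uKz C i n.
Proof. by case: n => n; rewrite /uKz ubarX ubar_gen. Qed.

Lemma uF_uKi (I : finType) (C : cartan_datum I) i :
  uF C i * uKi C i = qi C i ^- 2 *: (uKi C i * uF C i).
Proof.
rewrite -[LHS]mul1r -(uKiK C i) -mulrA [uK C i * _]mulrA uKF cartan_diag.
by rewrite -scalerAl -scalerAr -!mulrA uKKi mulr1.
Qed.

Lemma ubar_braid_gen (I : finType) (C : cartan_datum I) i
    (T : {lrmorphism Uq C -> Uq C}) (hT : is_braid_aut i T) g :
  ubar (T (uclass C (UGen g))) = T (uclass C (UGen g)).
Proof.
have bE j : ubar (uE C j) = uE C j by exact: ubar_gen.
have bF j : ubar (uF C j) = uF C j by exact: ubar_gen.
have bK j : ubar (uK C j) = uK C j by exact: ubar_gen.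
have bKi j : ubar (uKi C j) = uKi C j by exact: ubar_gen.
have q0 := qi_neq0 C i.
have bTK j : ubar (T (uK C j)) = T (uK C j).
  by rewrite (braid_K hT) ubarM bK ubar_uKz uK_uKz.
case: g => j.
- have [->|ji] := eqVneq j i.
    (* Bar turns $q_i^{-1}$ into $q_i$, and restoring the order of the factors costs $q_i^{-2}$. *)
    rewrite (braid_Ei hT) ubarZ ubarM bF bKi uF_uKi scalerA; congr (_ *: _).
    by rewrite fmorphV /= kbar_qi invrK expr2 invfM mulVKf.
  by rewrite (braid_E hT ji) ubar_braid_sum // eq_sym.
- have [->|ji] := eqVneq j i.
    rewrite (braid_Fi hT) ubarZ ubarM bE bK uKE scalerA; congr (_ *: _).
    rewrite fmorphV /= kbar_qi invrK cartan_diag (_ : 2 = 2%N%:Z) //.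
    by rewrite -exprnP expr2 mulKf.
  by rewrite (braid_F hT ji) ubar_braid_sum // eq_sym.
- exact: bTK.
(* Both sides are inverses of the bar-invariant element $T(K_j)$, hence equal. *)
- rewrite -[LHS]mulr1 -[X in _ * X](rmorph1 T) -(uKKi C j) rmorphM mulrA.
  by rewrite -[X in _ * X * _]bTK -ubarM -rmorphM uKKi rmorph1 ubar1 mul1r.
Qed.

(** Both composites are anti-linear anti-homomorphisms that agree on the generators. *)
Lemma ubar_braid (I : finType) (C : cartan_datum I) i
    (T : {lrmorphism Uq C -> Uq C}) (hT : is_braid_aut i T) (u : Uq C) :
  ubar (T u) = T (ubar u).
Proof.
elim/uclassW: u; elim=> [g|||x IHx y IHy|x IHx y IHy|c x IHx].
- by rewrite (ubar_braid_gen hT) ubar_gen.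
- by rewrite -[uclass _ _]/(0 : Uq C) raddf0 ubar0 raddf0.
- by rewrite -[uclass _ _]/(1 : Uq C) rmorph1 ubar1 rmorph1.
- by rewrite uclassD raddfD !ubarD IHx IHy raddfD.
- by rewrite uclassM rmorphM !ubarM IHx IHy rmorphM.
- by rewrite uclassZ linearZ !ubarZ IHx linearZ.
Qed.

(** * Root vectors and roots of a concatenated word *)

(** Bundles T_s as an algebra morphism, so that the generic morphism lemmas apply to it. *)
Lemma braid_word_lrmorphism (I : finType) (C : cartan_datum I)
    (T : I -> {lrmorphism Uq C -> Uq C}) s :
  exists f : {lrmorphism Uq C -> Uq C}, braid_word T s = f.
Proof.
elim: s => [|i s [f sf]]; first by exists idfun.
by exists (T i \o f); rewrite /= -sf.
Qed.

Lemma braid_word_cat (I : finType) (C : cartan_datum I) (T : I -> Uq C -> Uq C)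
    s t : braid_word T (s ++ t) = braid_word T s \o braid_word T t.
Proof. by elim: s => //= i s ->. Qed.

Lemma ubar_braid_word (I : finType) (C : cartan_datum I)
    (T : I -> {lrmorphism Uq C -> Uq C}) (hT : forall i, is_braid_aut i (T i))
    s (u : Uq C) : ubar (braid_word T s u) = braid_word T s (ubar u).
Proof. by elim: s => //= i s IH; rewrite (ubar_braid (hT i)) IH. Qed.

Lemma root_vector_lshift (I : finType) (C : cartan_datum I)
    (T : I -> Uq C -> Uq C) m n (s : m.-tuple I) (t : n.-tuple I) k :
  root_vector T [tuple of s ++ t] (lshift n k) = root_vector T s k.
Proof.
rewrite /root_vector tnth_lshift takel_cat // size_tuple.
exact: ltnW (ltn_ord k).
Qed.

Lemma root_vector_rshift (I : finType) (C : cartan_datum I)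
    (T : I -> Uq C -> Uq C) m n (s : m.-tuple I) (t : n.-tuple I) k :
  root_vector T [tuple of s ++ t] (rshift m k) =
    braid_word T s (root_vector T t k).
Proof.
rewrite /root_vector tnth_rshift take_cat size_tuple ltnNge leq_addr /=.
by rewrite addKn braid_word_cat.
Qed.

Lemma root_of_lshift (I : finType) (C : cartan_datum I)
    m n (s : m.-tuple I) (t : n.-tuple I) k :
  root_of C [tuple of s ++ t] (lshift n k) = root_of C s k.
Proof.
rewrite /root_of tnth_lshift takel_cat // size_tuple.
exact: ltnW (ltn_ord k).
Qed.

Lemma root_of_rshift (I : finType) (C : cartan_datum I)
    m n (s : m.-tuple I) (t : n.-tuple I) k :
  root_of C [tuple of s ++ t] (rshift m k) = refl_word C s (root_of C t k).
Proof.
rewrite /root_of tnth_rshift take_cat size_tuple ltnNge leq_addr /=.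
by rewrite addKn refl_word_cat.
Qed.

(** * PBW monomials with zero-padded exponents *)

Definition pad_right m n (b : m.-tuple nat) : (m + n).-tuple nat :=
  [tuple of b ++ nseq n 0%N].
Definition pad_left m n (b : n.-tuple nat) : (m + n).-tuple nat :=
  [tuple of nseq m 0%N ++ b].

Lemma pbw_monomial_pad_right (I : finType) (C : cartan_datum I)
    (T : I -> Uq C -> Uq C) m n (s : m.-tuple I) (t : n.-tuple I)
    (b : m.-tuple nat) :
  pbw_monomial T [tuple of s ++ t] (pad_right n b) = pbw_monomial T s b.
Proof.
have b0 (k : 'I_n) : tnth (pad_right n b) (rshift m k) = 0%N.
  by rewrite tnth_rshift tnth_nseq.
rewrite /pbw_monomial; congr (vq ^ _ *: _).
  rewrite big_split_ord /= [X in _ + X]big1 => [|k _]; last first.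
    by rewrite big1 // => l _; rewrite b0 mul0n mulr0.
  rewrite addr0; apply: eq_bigr => k _.
  rewrite big_split_ord /= [X in _ + X]big1 => [|l _]; last first.
    by rewrite b0 muln0 mulr0.
  rewrite addr0; apply: eq_bigr => l _.
  by rewrite !root_of_lshift !tnth_lshift.
rewrite big_split_ord /= [X in _ * X]big1 => [|k _]; last by rewrite b0 expr0.
by rewrite mulr1; apply: eq_bigr => k _; rewrite root_vector_lshift tnth_lshift.
Qed.

(** The roots of the second block are the images under s of those of t, so invariance of the form
    equates the q-exponents. *)
Lemma pbw_monomial_pad_left (I : finType) (C : cartan_datum I)
    (T : I -> {lrmorphism Uq C -> Uq C}) m n (s : m.-tuple I) (t : n.-tuple I)
    (b : n.-tuple nat) :
  pbw_monomial T [tuple of s ++ t] (pad_left m b) =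
    braid_word T s (pbw_monomial T t b).
Proof.
have b0 (k : 'I_m) : tnth (pad_left m b) (lshift n k) = 0%N.
  by rewrite tnth_lshift tnth_nseq.
have [f sf] := braid_word_lrmorphism T s.
rewrite /pbw_monomial sf linearZ rmorph_prod; congr (vq ^ _ *: _).
  rewrite big_split_ord /= [X in X + _]big1 => [|k _]; last first.
    by rewrite big1 // => l _; rewrite b0 mul0n mulr0.
  rewrite add0r; apply: eq_bigr => k _.
  rewrite big_split_ord /= [X in X + _]big1 => [|l _]; last first.
    by rewrite b0 muln0 mulr0.
  rewrite add0r; apply: eq_big => [l|l _]; first by rewrite ltn_add2l.
  by rewrite !root_of_rshift !tnth_rshift root_form_refl_word.
rewrite big_split_ord /= [X in X * _]big1 => [|k _]; last by rewrite b0 expr0.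
rewrite mul1r; apply: eq_bigr => k _.
by rewrite root_vector_rshift tnth_rshift rmorphXn sf.
Qed.

(** * Transport of the defining conditions *)

Lemma UA_cat_left (I : finType) (C : cartan_datum I) (T : I -> Uq C -> Uq C)
    m n (s : m.-tuple I) (t : n.-tuple I) x :
  UA T s x -> UA T [tuple of s ++ t] x.
Proof.
elim=> [k|||||]; [|by constructor..].
by rewrite -(root_vector_lshift T s t); exact: UA_gen.
Qed.

Lemma UA_cat_right (I : finType) (C : cartan_datum I)
    (T : I -> {lrmorphism Uq C -> Uq C}) m n (s : m.-tuple I) (t : n.-tuple I)
    x :
  UA T t x -> UA T [tuple of s ++ t] (braid_word T s x).
Proof.
have [f sf] := braid_word_lrmorphism T s.
elim=> [k||{}x y _ IHx _ IHy|{}x y _ IHx _ IHy|{}x _ IHx|{}x _ IHx].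
- by rewrite -root_vector_rshift; exact: UA_gen.
- by rewrite sf rmorph1; exact: UA_1.
- by move: IHx IHy; rewrite sf raddfB; exact: UA_sub.
- by move: IHx IHy; rewrite sf rmorphM; exact: UA_mul.
- by move: IHx; rewrite sf linearZ; exact: UA_vq.
- by move: IHx; rewrite sf linearZ; exact: UA_vqV.
Qed.

(** Injectivity of [g] preserves the exclusion of the leading exponent; its left inverse [h] carries
    the coefficients over. *)
Lemma lower_span_map (I : finType) (C : cartan_datum I)
    (T : I -> Uq C -> Uq C) m n (s : m.-tuple I) (t : n.-tuple I)
    (g : m.-tuple nat -> n.-tuple nat) (h : n.-tuple nat -> m.-tuple nat)
    (f : {linear Uq C -> Uq C}) (gK : cancel g h)
    (fg : forall b, f (pbw_monomial T s b) = pbw_monomial T t (g b)) b x :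
  lower_span T s b x -> lower_span T t (g b) (f x).
Proof.
move=> [r [c ->]]; exists (map g r), (c \o h).
rewrite big_map raddf_sum; apply: eq_big => [b'|b' _].
  by rewrite (inj_eq (can_inj gK)).
by rewrite /= gK -fg; exact: linearZ.
Qed.

Lemma pad_rightK m n :
  cancel (@pad_right m n) (fun b => [tuple tnth b (lshift n k) | k < m]).
Proof.
by move=> b; apply: eq_from_tnth => k; rewrite tnth_mktuple tnth_lshift.
Qed.

Lemma pad_leftK m n :
  cancel (@pad_left m n) (fun b => [tuple tnth b (rshift m k) | k < n]).
Proof.
by move=> b; apply: eq_from_tnth => k; rewrite tnth_mktuple tnth_rshift.
Qed.

Lemma is_dual_canonical_cat_left (I : finType) (C : cartan_datum I)
    (T : I -> Uq C -> Uq C) m n (s : m.-tuple I) (t : n.-tuple I) b x :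
  is_dual_canonical T s b x ->
  is_dual_canonical T [tuple of s ++ t] (pad_right n b) x.
Proof.
move=> [xA xb xl]; split=> //; first exact: UA_cat_left.
rewrite pbw_monomial_pad_right; move: xl.
apply: (lower_span_map (f := idfun) (@pad_rightK m n)) => b' /=.
by rewrite pbw_monomial_pad_right.
Qed.

Lemma is_dual_canonical_cat_right (I : finType) (C : cartan_datum I)
    (T : I -> {lrmorphism Uq C -> Uq C}) (hT : forall i, is_braid_aut i (T i))
    m n (s : m.-tuple I) (t : n.-tuple I) b x :
  is_dual_canonical T t b x ->
  is_dual_canonical T [tuple of s ++ t] (pad_left m b) (braid_word T s x).
Proof.
move=> [xA xb xl]; split; first exact: UA_cat_right.
  by rewrite ubar_braid_word // xb.
have [f sf] := braid_word_lrmorphism T s.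
rewrite pbw_monomial_pad_left sf -raddfB.
move: xl; apply: (lower_span_map (@pad_leftK m n)) => b'.
by rewrite pbw_monomial_pad_left sf.
Qed.

(** * Reduced words and the two inclusions *)

Lemma weyl_of_word_cat (I : finType) (C : cartan_datum I) s t :
  weyl_of_word C (s ++ t) = (weyl_of_word C s * weyl_of_word C t)%g.
Proof. by apply/val_inj; rewrite /= refl_word_cat. Qed.

Lemma reduced_words_neq0 (I : finType) (C : cartan_datum I) (w : weyl C) :
  reduced_words w !=set0.
Proof.
rewrite /reduced_words /weyl_length; case: ex_minnP => n /asboolP[s [sn ws]] _.
by exists (tcast sn (in_tuple s)); rewrite /= val_tcast.
Qed.

(** Keeping [n] a variable lets a word typed by the sum of two lengths be used without casting
    tuples. *)
Lemma dual_canonical_basisI (I : finType) (C : cartan_datum I)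
    (T : I -> Uq C -> Uq C) (w : weyl C) n (s : n.-tuple I) b x :
  weyl_length w = n -> weyl_of_word C s = w -> is_dual_canonical T s b x ->
  dual_canonical_basis T w x.
Proof. by move=> wn; subst n => ws xs; exists s => //; exists b. Qed.

Theorem theorem1p5 (I : finType) (C : cartan_datum I)
    (T : I -> {lrmorphism Uq C -> Uq C})
    (hT : forall i, is_braid_aut i (T i))
    (w w' : weyl C)
    (hw : weyl_length (w * w')%g = (weyl_length w + weyl_length w')%N) :
  dual_canonical_basis T w `<=` dual_canonical_basis T (w * w')%g /\
  forall s, reduced_words w s ->
    braid_word T s @` dual_canonical_basis T w'
      `<=` dual_canonical_basis T (w * w')%g.
Proof.
split=> [x [s sw [b xb]]|s sw _ [x [t tw [b xb]] <-]].
- have [t tw] := reduced_words_neq0 w'.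
  (* Additivity of lengths is what makes the concatenation reduced. *)
  apply: (dual_canonical_basisI hw) (is_dual_canonical_cat_left t xb).
  by rewrite weyl_of_word_cat sw tw.
- apply: (dual_canonical_basisI hw) (is_dual_canonical_cat_right hT s xb).
  by rewrite weyl_of_word_cat sw tw.
Qed.
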